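(* Let $\mathcal{C}$ be a small preadditive category with set of objects $\mathcal{C}_0$, let $F:\mathcal{C}\to\mathcal{A}b$ be an additive contravariant functor and $A\in\mathcal{C}_0$. Consider the $\mathcal{C}_0\times\mathcal{C}_0$-graded right $R[\mathcal{C}]$-module $M[F]$ with $M[F]_{(A,B)}=F(B)$ for each $B\in\mathcal{C}_0$. Let $(A_i)_{i\in I}\in\mathcal{C}_0^I$ and $(x_i)_{i\in I}\in\prod_{i\in I}F(A_i)=\prod_{i\in I}M[F]_{(A,A_i)}$. The following statements are equivalent: (1) $F$ is a free functor with basis $(x_i)_{i\in I}\in\prod_{i\in I}F(A_i)$. (2) $M[F]$ is a pseudo-free right $R[\mathcal{C}]$-module with pseudo-basis $(x_i)_{i\in I}\in\prod_{i\in I}M[F]_{(A,A_i)}$. (3) The natural transformation $\bigoplus_{i\in I}\mathcal{C}(-,A_i)\to F$ determined by $I_{A_i}\mapsto x_i$ is an isomorphism in $\mathrm{Fun}(\mathcal{C}^{op},\mathcal{A}b)$.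
   Context: A small preadditive category $\mathcal{C}$ has a set of objects $\mathcal{C}_0$ and abelian groups $\mathcal{C}(A,B)$ of morphisms $A\to B$ with $\mathbb{Z}$-bilinear composition; $I_X$ is the identity of $X$; $\mathcal{A}b$ is the category of abelian groups; $\mathrm{Fun}(\mathcal{C}^{op},\mathcal{A}b)$ is the category of additive contravariant functors $\mathcal{C}\to\mathcal{A}b$. A sequence $(x_i)_{i\in I}\in\prod_{i\in I}F(A_i)$ is a basis of $F$ (and $F$ is then free) if for all $B\in\mathcal{C}_0$ and $x\in F(B)$ there is a unique $(\lambda_i)_{i\in I}\in\bigoplus_{i\in I}\mathcal{C}(B,A_i)$ with $x=\sum_{i}F(\lambda_i)(x_i)$. $\mathcal{G}=\mathcal{C}_0\times\mathcal{C}_0$ is the groupoid with $r(Y,X)=Y$, $d(Y,X)=X$, $(Z,Y)(Y,X)=(Z,X)$ and idempotents $\varepsilon_A=(A,A)$. $R=R[\mathcal{C}]=\bigoplus_{A,B}\mathcal{C}(A,B)$ is the ring with product $fg=f\circ g$ when the composition makes sense and $0$ otherwise; it is $\mathcal{G}$-graded by $R_{(A,B)}=\mathcal{C}(B,A)$, and $1_{\varepsilon_X}=I_X$. A $\mathcal{G}$-graded right $R$-module is a right module $M=\bigoplus_\gamma M_\gamma$ with $M_\gamma R_\delta\subseteq M_{\gamma\delta}$ (zero if $\gamma\delta$ is undefined) and $MR=M$. $M[F]=\bigoplus_{X\in\mathcal{C}_0}F(X)$ is the right $R[\mathcal{C}]$-module with, for $m\in F(Z)$ and $f\in\mathcal{C}(X,Y)$,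 $mf:=F(f)(m)\in F(X)$ if $Z=Y$ and $mf:=0$ if $Z\neq Y$; its components of degree $(B,X)$ with $B\neq A$ are zero. A sequence $(x_i)_{i\in I}\in\prod_iM_{\gamma_i}$ in a $\mathcal{G}$-graded right $R$-module $M$ is a pseudo-basis of $M$ (and $M$ is then pseudo-free) if it generates $M$ and the only $(a_i)\in\bigoplus_i1_{d(\gamma_i)}R$ with $\sum x_ia_i=0$ is $(a_i)=0$. *)

(* Defs.v *)
From HB Require Import structures.
From mathcomp Require Import all_boot all_algebra finmap.
From mathcomp Require Import boolp classical_sets functions.
From mathcomp Require Import cardinality fsbigop.

Set Implicit Arguments.
Unset Strict Implicit.
Unset Printing Implicit Defensive.
Import GRing.Theory.
Local Open Scope classical_set_scope.
Local Open Scope ring_scope.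

(* Sets of objects and of indices are [choiceType]s, as [fsbigop] requires;   *)
(* with the axioms of [boolp] every type carries such a structure.            *)

Lemma add_zmod_morphism (U V : zmodType) (f : U -> V) :
  (forall u v, f (u + v) = f u + f v) -> zmod_morphism f.
Proof. by move=> fD u v; apply: (@addIr _ (f v)); rewrite -fD !subrK. Qed.

Section DirectSum.
Variables (I : choiceType) (V : I -> zmodType).

Definition finite_supp (f : forall i, V i) : bool :=
  `[< finite_set [set i | f i != 0] >].

Record dsum := DSum { dsum_val :> forall i, V i; _ : finite_supp dsum_val }.

HB.instance Definition _ := [isSub for dsum_val].
HB.instance Definition _ := [Choice of dsum by <:].

Lemma dsum_finite (f : dsum) : finite_set [set i | f i != 0].
Proof. by case: f => f /= /asboolP. Qed.

Lemma dsumP (f g : dsum) : (forall i, f i = g i) -> f = g.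
Proof. by move=> fg; apply/val_inj/functional_extensionality_dep. Qed.

Fact dsum_zero_subproof : finite_supp (fun i => 0 : V i).
Proof.
by apply/asboolP; rewrite [X in finite_set X](_ : _ = set0)//;
  apply/seteqP; split=> // i /=; rewrite eqxx.
Qed.
Definition dsum_zero := DSum dsum_zero_subproof.

Fact dsum_opp_subproof (f : dsum) : finite_supp (fun i => - f i).
Proof.
apply/asboolP; apply: sub_finite_set (dsum_finite f) => i /=.
by rewrite oppr_eq0.
Qed.
Definition dsum_opp f := DSum (dsum_opp_subproof f).

Fact dsum_add_subproof (f g : dsum) : finite_supp (fun i => f i + g i).
Proof.
apply/asboolP.
have fin : finite_set ([set i | f i != 0] `|` [set i | g i != 0]).
  by rewrite finite_setU; split; apply: dsum_finite.
apply: sub_finite_set fin => i /= fg.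
by have [f0|] := eqVneq (f i) 0; [right; rewrite f0 add0r in fg|left].
Qed.
Definition dsum_add f g := DSum (dsum_add_subproof f g).

Fact dsum_addA : associative dsum_add.
Proof. by move=> f g h; apply: dsumP => i /=; rewrite addrA. Qed.
Fact dsum_addC : commutative dsum_add.
Proof. by move=> f g; apply: dsumP => i /=; rewrite addrC. Qed.
Fact dsum_add0 : left_id dsum_zero dsum_add.
Proof. by move=> f; apply: dsumP => i /=; rewrite add0r. Qed.
Fact dsum_addN : left_inverse dsum_zero dsum_opp dsum_add.
Proof. by move=> f; apply: dsumP => i /=; rewrite addNr. Qed.
HB.instance Definition _ :=
  GRing.isZmodule.Build dsum dsum_addA dsum_addC dsum_add0 dsum_addN.

Lemma dsum0E i : (0 : dsum) i = 0. Proof. by []. Qed.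
Lemma dsumDE (f g : dsum) i : (f + g) i = f i + g i. Proof. by []. Qed.
Lemma dsumNE (f : dsum) i : (- f) i = - f i. Proof. by []. Qed.
Lemma dsumBE (f g : dsum) i : (f - g) i = f i - g i. Proof. by []. Qed.

Fact dinj_subproof i (v : V i) : finite_supp (dfwith (fun j => 0 : V j) v).
Proof.
apply/asboolP; apply: sub_finite_set (finite_set1 i) => j /=.
by case: dfwithP => [//|k ik]; rewrite eqxx.
Qed.
Definition dinj i (v : V i) : dsum := DSum (dinj_subproof v).

Lemma dinjE i (v : V i) : dinj v i = v.
Proof. exact: dfwith_in. Qed.

Lemma dinj_neq i j (v : V i) : i != j -> dinj v j = 0.
Proof. exact: dfwith_out. Qed.

Fact dinj_is_zmod_morphism i : zmod_morphism (@dinj i).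
Proof.
move=> u v; apply: dsumP => j; rewrite dsumBE.
by have [<-|ij] := eqVneq i j; rewrite ?dinjE// !dinj_neq// subr0.
Qed.
HB.instance Definition _ i :=
  GRing.isZmodMorphism.Build (V i) dsum (@dinj i) (dinj_is_zmod_morphism (i := i)).

Definition supp (f : dsum) : {fset I} := fset_set [set i | f i != 0].

Lemma notin_supp (f : dsum) i : i \notin supp f -> f i = 0.
Proof.
by move=> /negP; rewrite in_fset_set ?inE; last exact: dsum_finite;
  move=> /negP /negPn /eqP.
Qed.

Lemma dsum_decomp (f : dsum) (s : {fset I}) :
  (forall i, i \notin s -> f i = 0) -> f = \sum_(i <- s) dinj (f i).
Proof.
move=> fs; apply: dsumP => j.
have -> : (\sum_(i <- s) dinj (f i)) j = \sum_(i <- s) dinj (f i) j.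
  by elim/big_rec2: _ => // i y x _ <-.
have [js|js] := boolP (j \in s).
  rewrite (big_fsetD1 j)// dinjE big1_seq; first by rewrite [RHS]addr0.
  move=> i.
  by rewrite in_fsetD1 => /and3P[_ ij _]; rewrite dinj_neq.
rewrite big1_seq ?fs// => i /andP[_ si]; rewrite dinj_neq//.
by apply: contraNneq js => <-.
Qed.

Lemma dsum_ind (P : dsum -> Prop) :
    P 0 -> (forall f g, P f -> P g -> P (f + g)) ->
    (forall i (v : V i), P (dinj v)) -> forall f, P f.
Proof.
move=> P0 PD Pi f; rewrite (dsum_decomp (@notin_supp f)).
by elim/big_ind: _ => // i _; apply: Pi.
Qed.

Section Lift.
Variables (W : zmodType) (g : forall i, {additive V i -> W}).

Definition dlift (f : dsum) : W := \sum_(i \in [set: I]) g i (f i).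

Lemma dlift_widen (f : dsum) (s : {fset I}) :
  (forall i, i \notin s -> f i = 0) -> dlift f = \sum_(i <- s) g i (f i).
Proof.
move=> fs; rewrite /dlift (fsbigE s); [|exact: fset_uniq|by []|].
- by rewrite big_mkcond/=; apply: eq_bigr => i _; rewrite ifT// in_setT.
- by move=> i _ /fs ->; rewrite raddf0.
Qed.

Fact dlift_is_zmod_morphism : zmod_morphism dlift.
Proof.
move=> u v; pose s := (supp u `|` supp v)%fset.
have su i : i \notin s -> u i = 0.
  by rewrite in_fsetU negb_or => /andP[/notin_supp].
have sv i : i \notin s -> v i = 0.
  by rewrite in_fsetU negb_or => /andP[_ /notin_supp].
rewrite !(@dlift_widen _ s)//; last first.
  by move=> i si; rewrite dsumBE su// sv// subr0.
by rewrite -sumrB; apply: eq_bigr => i _; rewrite dsumBE raddfB.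
Qed.
HB.instance Definition _ :=
  GRing.isZmodMorphism.Build dsum W dlift dlift_is_zmod_morphism.

Lemma dlift_dinj i (v : V i) : dlift (dinj v) = g i v.
Proof.
rewrite (@dlift_widen _ [fset i]%fset).
  by rewrite big_seq_fset1 dinjE.
by move=> j; rewrite in_fset1 => ji; rewrite dinj_neq// eq_sym.
Qed.
End Lift.

Definition dproj i (f : dsum) : V i := f i.
HB.instance Definition _ i := GRing.isZmodMorphism.Build dsum (V i) (dproj i)
  (fun f g => dsumBE f g i).
End DirectSum.

Arguments dinj {I} V {i} v : simpl never.
Arguments dsum_val : simpl never.

Section Bilinear.
Variables (I J : choiceType) (V : I -> zmodType) (W : J -> zmodType).
Variables (U : zmodType) (b : forall i j, V i -> W j -> U).
Hypothesis bDl : forall i j v v' (w : W j),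
  b (v + v' : V i) w = b v w + b v' w.
Hypothesis bDr : forall i j (v : V i) (w w' : W j),
  b v (w + w') = b v w + b v w'.

Definition dlift2 (f : dsum V) (k : dsum W) : U :=
  \sum_(i \in [set: I]) \sum_(j \in [set: J]) b (f i) (k j).

Let br i (v : V i) j (w : W j) := b v w.
HB.instance Definition _ i (v : V i) j :=
  GRing.isZmodMorphism.Build (W j) U (@br i v j)
    (add_zmod_morphism (@bDr i j v)).

Let bl (k : dsum W) i (v : V i) : U := dlift (fun j => @br i v j) k.

Let blD k i (u v : V i) : bl k (u + v) = bl k u + bl k v.
Proof.
rewrite /bl; elim/dsum_ind: k => [|k l IHk IHl|j w].
- by rewrite !raddf0 addr0.
- by rewrite !raddfD /= IHk IHl addrACA.
- by rewrite !dlift_dinj; apply: bDl.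
Qed.

HB.instance Definition _ k i :=
  GRing.isZmodMorphism.Build (V i) U (@bl k i) (add_zmod_morphism (@blD k i)).

Let dlift2E f k : dlift2 f k = dlift (fun i => @bl k i) f.
Proof. by []. Qed.

Lemma dlift2Dl f f' k : dlift2 (f + f') k = dlift2 f k + dlift2 f' k.
Proof. by rewrite !dlift2E raddfD. Qed.

Lemma dlift2Dr f k k' : dlift2 f (k + k') = dlift2 f k + dlift2 f k'.
Proof.
rewrite !dlift2E; elim/dsum_ind: f => [|f g IHf IHg|i v].
- by rewrite !raddf0 addr0.
- by rewrite !raddfD /= IHf IHg addrACA.
- by rewrite !dlift_dinj /= /bl raddfD.
Qed.

Lemma dlift2_dinj i j (v : V i) (w : W j) :
  dlift2 (dinj V v) (dinj W w) = b v w.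
Proof. by rewrite dlift2E dlift_dinj /= /bl dlift_dinj. Qed.
End Bilinear.

Record preadditive := Preadditive {
  ob :> choiceType;
  hom : ob -> ob -> zmodType;
  idm : forall X, hom X X;
  comp : forall X Y Z, hom Y Z -> hom X Y -> hom X Z;
  compA : forall X Y Z T (f : hom Z T) (g : hom Y Z) (h : hom X Y),
    comp f (comp g h) = comp (comp f g) h;
  comp1l : forall X Y (f : hom X Y), comp (idm Y) f = f;
  comp1r : forall X Y (f : hom X Y), comp f (idm X) = f;
  compDl : forall X Y Z (f g : hom Y Z) (h : hom X Y),
    comp (f + g) h = comp f h + comp g h;
  compDr : forall X Y Z (f : hom Y Z) (g h : hom X Y),
    comp f (g + h) = comp f g + comp f h }.

Arguments idm {p} X.
Arguments comp {p X Y Z}.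

Record cofunctor (C : preadditive) := Cofunctor {
  fobj :> C -> zmodType;
  fmap : forall X Y, hom X Y -> {additive fobj Y -> fobj X};
  fmapD : forall X Y (f g : hom X Y) u, fmap (f + g) u = fmap f u + fmap g u;
  fmap1 : forall X u, fmap (idm X) u = u;
  fmap_comp : forall X Y Z (f : hom Y Z) (g : hom X Y) u,
    fmap (comp f g) u = fmap g (fmap f u) }.

Arguments fmap {C} F {X Y} : rename.

Record nat_trans (C : preadditive) (F G : cofunctor C) := NatTrans {
  nt_comp :> forall X, {additive F X -> G X};
  nt_natural : forall X Y (f : hom X Y) u,
    nt_comp X (fmap F f u) = fmap G f (nt_comp Y u) }.

Definition nat_iso (C : preadditive) (F G : cofunctor C)
    (t : nat_trans F G) : Prop :=
  exists t' : nat_trans G F,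
    (forall X, cancel (t X) (t' X)) /\ (forall X, cancel (t' X) (t X)).

Section Representable.
Variable C : preadditive.

Fact compr_is_zmod_morphism X Y Z (g : @hom C X Y) :
  zmod_morphism (fun f : hom Y Z => comp f g).
Proof. by apply: add_zmod_morphism => f h; apply: compDl. Qed.

Definition precomp X Y Z (g : @hom C X Y) (f : hom Y Z) := comp f g.
HB.instance Definition _ X Y Z (g : @hom C X Y) :=
  GRing.isZmodMorphism.Build (hom Y Z) (hom X Z) (@precomp X Y Z g)
    (compr_is_zmod_morphism g).

Definition rep (A : C) : cofunctor C.
Proof.
refine (@Cofunctor C (fun X => hom X A) (fun X Y f => @precomp X Y A f) _ _ _).
- by move=> X Y f g u; apply: compDr.
- by move=> X u; apply: comp1r.
- by move=> X Y Z f g u; apply: compA.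
Defined.

Fact fmapr_is_zmod_morphism (F : cofunctor C) X Y (u : F Y) :
  zmod_morphism (fun f : hom X Y => fmap F f u).
Proof. by apply: add_zmod_morphism => f g; apply: fmapD. Qed.

Definition feval (F : cofunctor C) X Y (u : F Y) (f : hom X Y) := fmap F f u.
HB.instance Definition _ (F : cofunctor C) X Y (u : F Y) :=
  GRing.isZmodMorphism.Build (hom X Y) (F X) (@feval F X Y u)
    (fmapr_is_zmod_morphism u).

Definition yoneda (F : cofunctor C) A (x : F A) : nat_trans (rep A) F.
Proof.
refine (@NatTrans C (rep A) F (fun X => @feval F X A x) _).
by move=> X Y f u; apply: fmap_comp.
Defined.

Section FunctorSum.
Variables (I : choiceType) (G : I -> cofunctor C).

Definition dsum_fobj X : zmodType := dsum (fun i => G i X).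

Fact dsum_fmap_subproof X Y (f : hom X Y) (u : dsum_fobj Y) :
  finite_supp (fun i => fmap (G i) f (u i)).
Proof.
apply/asboolP; apply: sub_finite_set (dsum_finite u) => i /=.
by apply: contra_neq => ->; rewrite raddf0.
Qed.
Definition dsum_fmap X Y (f : hom X Y) (u : dsum_fobj Y) : dsum_fobj X :=
  DSum (dsum_fmap_subproof f u).

Fact dsum_fmap_is_zmod_morphism X Y (f : hom X Y) :
  zmod_morphism (dsum_fmap f).
Proof. by move=> u v; apply: dsumP => i; apply: raddfB. Qed.
HB.instance Definition _ X Y (f : hom X Y) :=
  GRing.isZmodMorphism.Build (dsum_fobj Y) (dsum_fobj X) (dsum_fmap f)
    (dsum_fmap_is_zmod_morphism f).

Definition dsum_functor : cofunctor C.
Proof.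
refine (@Cofunctor C dsum_fobj (fun X Y f => @dsum_fmap X Y f) _ _ _).
- by move=> X Y f g u; apply: dsumP => i; apply: fmapD.
- by move=> X u; apply: dsumP => i; apply: fmap1.
- by move=> X Y Z f g u; apply: dsumP => i; apply: fmap_comp.
Defined.

Lemma dsum_fmap_dinj X Y (f : hom X Y) i (u : G i Y) :
  fmap dsum_functor f (dinj (fun i => G i Y) u) =
  dinj (fun i => G i X) (fmap (G i) f u).
Proof.
apply: dsumP => j; rewrite [LHS]/(fmap _ _ _).
have [<-|ij] := eqVneq i j; first by rewrite !dinjE.
by rewrite !dinj_neq//; apply: raddf0.
Qed.

Definition dsum_trans (F : cofunctor C) (t : forall i, nat_trans (G i) F) :
  nat_trans dsum_functor F.
Proof.
refine (@NatTrans C dsum_functor F (fun X => dlift (fun i => t i X)) _).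
move=> X Y f; elim/dsum_ind => [|u v IHu IHv|i u].
- by rewrite !raddf0.
- by rewrite !raddfD IHu IHv.
- by rewrite dsum_fmap_dinj /= !dlift_dinj nt_natural.
Defined.
End FunctorSum.

Section Basis.
Variables (F : cofunctor C) (I : choiceType) (A : I -> C).
Variable x : forall i, F (A i).

Definition is_basis : Prop :=
  forall (B : C) (y : F B), exists! l : dsum (fun i => hom B (A i)),
    y = \sum_(i \in [set: I]) fmap F (l i) (x i).

Definition rep_sum : cofunctor C := dsum_functor (fun i => rep (A i)).

(* The transformation determined by idm (A i) |-> x i: see the two lemmas. *)
Definition rep_trans : nat_trans rep_sum F := dsum_trans (fun i => yoneda (x i)).

Lemma rep_trans_idm i :
  rep_trans (A i) (dinj (fun j => rep (A j) (A i)) (idm (A i))) = x i.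
Proof. by rewrite /= dlift_dinj /= /feval fmap1. Qed.

Lemma rep_trans_unique (t : nat_trans rep_sum F) :
    (forall i,
      t (A i) (dinj (fun j => rep (A j) (A i)) (idm (A i))) = x i) ->
  forall X l, t X l = rep_trans X l.
Proof.
move=> tx X; elim/dsum_ind => [|u v IHu IHv|i f]; rewrite ?raddf0 ?raddfD//.
  by rewrite IHu IHv.
have -> : dinj (fun j => rep (A j) X) f = fmap rep_sum f
    (dinj (fun j => rep (A j) (A i)) (idm (A i))).
  by rewrite dsum_fmap_dinj /= /precomp comp1l.
by rewrite !nt_natural tx rep_trans_idm.
Qed.
End Basis.
End Representable.

(* Rings need not have an identity element. *)
Record rng := Rng {
  rng_sort :> zmodType;
  rmul : rng_sort -> rng_sort -> rng_sort;
  rmulA : associative rmul;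
  rmulDl : left_distributive rmul +%R;
  rmulDr : right_distributive rmul +%R }.

Record rmodule (R : rng) := RModule {
  rmodule_sort :> zmodType;
  ract : rmodule_sort -> R -> rmodule_sort;
  ractA : forall m a b, ract (ract m a) b = ract m (rmul a b);
  ractDl : forall m n a, ract (m + n) a = ract m a + ract n a;
  ractDr : forall m a b, ract m (a + b) = ract m a + ract m b }.

Arguments rmul {r}.
Arguments ract {R r}.

Definition subgroup (M : zmodType) (N : set M) : Prop :=
  N 0 /\ forall m n, N m -> N n -> N (m - n).

Definition submodule (R : rng) (M : rmodule R) (N : set M) : Prop :=
  subgroup N /\ forall n (a : R), N n -> N (ract n a).

(* M is the internal direct sum of the subgroups S g. *)
Definition is_grading (G : choiceType) (M : zmodType) (S : G -> set M) : Prop :=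
  (forall g, subgroup (S g)) /\
  forall m, exists! c : dsum (fun _ : G => M),
    (forall g, S g (c g)) /\ m = \sum_(g \in [set: G]) c g.

Section Groupoid.
Variable T : choiceType.

(* An object A of the groupoid T x T stands for the idempotent (A, A). *)
Definition gran (g : T * T) : T := g.1.
Definition gdom (g : T * T) : T := g.2.
Definition gmul (g h : T * T) : option (T * T) :=
  if gdom g == gran h then Some (gran g, gdom h) else None.

Definition comp_at (M : zmodType) (S : T * T -> set M) (o : option (T * T)) :
  set M := if o is Some g then S g else [set 0].

(* [gone A] is the identity 1_(A, A) of the component of degree (A, A). *)
Record graded_rng := GradedRng {
  grng :> rng;
  grng_comp : T * T -> set grng;
  grng_grading : is_grading grng_comp;
  grng_mul : forall g h a b, grng_comp g a -> grng_comp h b ->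
    comp_at grng_comp (gmul g h) (rmul a b);
  gone : T -> grng;
  gone_comp : forall A, grng_comp (A, A) (gone A);
  gone_l : forall g a, grng_comp g a -> rmul (gone (gran g)) a = a;
  gone_r : forall g a, grng_comp g a -> rmul a (gone (gdom g)) = a }.

Record graded_module (R : graded_rng) := GradedModule {
  gmodule :> rmodule R;
  gmodule_comp : T * T -> set gmodule;
  gmodule_grading : is_grading gmodule_comp;
  gmodule_act : forall g h m a, gmodule_comp g m -> grng_comp h a ->
    comp_at gmodule_comp (gmul g h) (ract m a);
  gmodule_unital : forall m, exists s : seq (gmodule * R),
    m = \sum_(p <- s) ract p.1 p.2 }.

Definition generates (R : rng) (M : rmodule R) (I : Type) (x : I -> M) : Prop :=
  forall N : set M, submodule N -> (forall i, N (x i)) -> N = setT.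

Definition pseudo_basis (R : graded_rng) (M : graded_module R) (I : choiceType)
    (g : I -> T * T) (x : I -> M) : Prop :=
  [/\ forall i, gmodule_comp (g i) (x i),
      generates x &
      forall a : dsum (fun _ : I => R : zmodType),
        (forall i, exists r, a i = rmul (gone R (gdom (g i))) r) ->
        \sum_(i \in [set: I]) ract (x i) (a i) = 0 -> a = 0].
End Groupoid.

(* A direct sum, with its i-th summand placed in degree k i. *)
Section DsumGrading.
Variables (I G : choiceType) (V : I -> zmodType) (k : I -> G).
Variable S : G -> set (dsum V).
Hypothesis S_k : forall i, S (k i) = range (@dinj I V i).
Hypothesis S_0 : forall g, (exists i, g = k i) \/ S g = [set 0].

Let S_subgroup g : subgroup (S g).
Proof.
case: (S_0 g) => [[i ->]|->]; rewrite ?S_k.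
  split; first by exists 0; rewrite ?raddf0.
  by move=> _ _ [u _ <-] [v _ <-]; exists (u - v); rewrite ?raddfB.
by split=> // _ _ -> ->; rewrite subr0.
Qed.

Let D := dsum (fun _ : G => dsum V).
Let place i : {additive V i -> D} :=
  @dinj G (fun _ => dsum V) (k i) \o @dinj I V i.
Let split_ : dsum V -> D := dlift place.
Let total : D -> dsum V := dlift (fun g => @idfun (dsum V)).

Let split_S m g : S g (split_ m g).
Proof.
rewrite /split_; elim/dsum_ind: m => [|m n IHm IHn|i v].
- by rewrite raddf0; case: (S_subgroup g).
- have [S0 SB] := S_subgroup g.
  rewrite raddfD dsumDE -[X in _ + X]opprK; apply: (SB) => //.
  by rewrite -sub0r; apply: SB.
- rewrite dlift_dinj /=; have [<-|kg] := eqVneq (k i) g.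
    by rewrite dinjE S_k; exists v.
  by rewrite dinj_neq//; case: (S_subgroup g).
Qed.

Let split_total m : total (split_ m) = m.
Proof.
rewrite /total /split_; elim/dsum_ind: m => [|m n IHm IHn|i v].
- by rewrite !raddf0.
- by rewrite !raddfD /= IHm IHn.
- by rewrite dlift_dinj /= dlift_dinj.
Qed.

Let total_at (c : D) i : (forall g, S g (c g)) -> total c i = c (k i) i.
Proof.
move=> cS; pose s := (k i |` supp c)%fset.
have cs g : g \notin s -> c g = 0.
  by rewrite in_fset1U negb_or => /andP[_ /notin_supp].
rewrite /total (dlift_widen _ cs).
rewrite -[LHS]/(@dproj I V i _) raddf_sum (big_fsetD1 (k i)) ?fset1U1//=.
rewrite big1_seq ?addr0// => g; rewrite in_fsetD1 => /and3P[_ gk _].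
rewrite /dproj; have := cS g; case: (S_0 g) => [[j gj]|->]; last by move=> ->.
subst g; rewrite S_k => -[v _ <-]; rewrite dinj_neq//.
by apply: contra_neq gk => ->.
Qed.

Lemma dsum_grading : is_grading S.
Proof.
split=> [//|m]; exists (split_ m); split.
  split=> //; by rewrite -[LHS]split_total.
move=> c [cS mc]; apply: dsumP => g.
have {}mc : m = total c by [].
have := split_S m g; have := cS g.
case: (S_0 g) => [[j ->]|->]; last by move=> -> ->.
rewrite S_k => -[u _ cu] [v _ mv]; rewrite -cu -mv; congr dinj.
by rewrite -[LHS](@dinjE _ V j) -[RHS](@dinjE _ V j) cu mv -!total_at//
  split_total mc.
Qed.
End DsumGrading.

Section CategoryRing.
Variable C : preadditive.

(* R[C] has component C(B, A) in degree (A, B). *)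
Definition rhom (g : C * C) : zmodType := hom (gdom g) (gran g).

(* Product of homogeneous elements: the composite if it makes sense, else 0. *)
Definition hmul (g h : C * C) (a : rhom g) (b : rhom h) : dsum rhom :=
  if gran h =P gdom g is ReflectT e then
    @dinj _ rhom (gran g, gdom h) (comp a (ecast Y (hom (gdom h) Y) e b))
  else 0.

Lemma hmulE X Y Z (a : hom Y Z) (b : hom X Y) :
  @hmul (Z, Y) (Y, X) a b = @dinj _ rhom (Z, X) (comp a b).
Proof. by rewrite /hmul; case: eqP => //= e; rewrite eq_axiomK. Qed.

Lemma hmul_neq g h (a : rhom g) (b : rhom h) :
  gdom g != gran h -> hmul a b = 0.
Proof. by rewrite /hmul; case: eqP => // e /eqP[]; rewrite e. Qed.

Fact hmulDl g h (a a' : rhom g) (b : rhom h) :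
  hmul (a + a') b = hmul a b + hmul a' b.
Proof.
rewrite /hmul; case: eqP => e; last by rewrite addr0.
by rewrite compDl raddfD.
Qed.

Fact hmulDr g h (a : rhom g) (b b' : rhom h) :
  hmul a (b + b') = hmul a b + hmul a b'.
Proof.
case: g h a b b' => Z Y [Y' X] a b b'.
have [e|ne] := eqVneq Y Y'; last by rewrite !hmul_neq ?addr0.
by subst Y'; rewrite !hmulE compDr raddfD.
Qed.

Definition cmul : dsum rhom -> dsum rhom -> dsum rhom := dlift2 hmul.

Lemma cmulDl : left_distributive cmul +%R.
Proof. by move=> f g h; apply: dlift2Dl; [exact: hmulDl|exact: hmulDr]. Qed.

Lemma cmulDr : right_distributive cmul +%R.
Proof. by move=> f g h; apply: dlift2Dr; [exact: hmulDl|exact: hmulDr]. Qed.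

Lemma cmul0l f : cmul 0 f = 0.
Proof. by apply: (@addIr _ (cmul 0 f)); rewrite -cmulDl !add0r. Qed.

Lemma cmul0r f : cmul f 0 = 0.
Proof. by apply: (@addIr _ (cmul f 0)); rewrite -cmulDr !add0r. Qed.

Lemma cmul_dinj g h (a : rhom g) (b : rhom h) :
  cmul (dinj rhom a) (dinj rhom b) = hmul a b.
Proof. by apply: dlift2_dinj; [exact: hmulDl|exact: hmulDr]. Qed.

Fact cmulA : associative cmul.
Proof.
elim/dsum_ind => [|f f' IH IH'|g a] u v; first by rewrite !cmul0l.
  by rewrite !cmulDl IH IH'.
elim/dsum_ind: u => [|f f' IH IH'|h b]; first by rewrite !(cmul0l, cmul0r).
  by rewrite !(cmulDl, cmulDr) IH IH'.
elim/dsum_ind: v => [|f f' IH IH'|k c]; first by rewrite !cmul0r.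
  by rewrite !cmulDr IH IH'.
case: g h k a b c => [Z Y] [Y' X] [X' W] a b c; rewrite !cmul_dinj.
have [e|ne] := eqVneq X X'; last first.
  rewrite [hmul b c]hmul_neq// cmul0r.
  have [e|ne'] := eqVneq Y Y'; last by rewrite hmul_neq// cmul0l.
  by subst Y'; rewrite hmulE cmul_dinj hmul_neq.
subst X'; rewrite [hmul b c]hmulE cmul_dinj.
have [e|ne'] := eqVneq Y Y'; last by rewrite !hmul_neq// cmul0l.
by subst Y'; rewrite !hmulE cmul_dinj hmulE compA.
Qed.

Definition cat_rng : rng := Rng cmulA cmulDl cmulDr.

Definition cat_comp (g : C * C) : set cat_rng := range (@dinj _ rhom g).

Fact cat_grading : is_grading cat_comp.
Proof. by apply: (@dsum_grading _ _ rhom id) => // g; left; exists g. Qed.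

Fact cat_grng_mul g h a b : cat_comp g a -> cat_comp h b ->
  comp_at cat_comp (gmul g h) (rmul a b).
Proof.
case: g h => [Z Y] [Y' X] [f _ <-] [f' _ <-].
rewrite [rmul _ _]cmul_dinj /gmul/=; have [e|ne] := eqVneq Y Y'.
  by subst Y'; rewrite hmulE; exists (comp f f').
by rewrite hmul_neq.
Qed.

Definition cat_one (X : C) : cat_rng := @dinj _ rhom (X, X) (idm X).

Fact cat_one_comp X : cat_comp (X, X) (cat_one X).
Proof. by exists (idm X). Qed.

Fact cat_one_l g a : cat_comp g a -> rmul (cat_one (gran g)) a = a.
Proof.
by case: g => Y X [f _ <-]; rewrite [LHS]cmul_dinj hmulE comp1l.
Qed.

Fact cat_one_r g a : cat_comp g a -> rmul a (cat_one (gdom g)) = a.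
Proof.
by case: g => Y X [f _ <-]; rewrite [LHS]cmul_dinj hmulE comp1r.
Qed.

Definition cat_ring : graded_rng C :=
  GradedRng cat_grading cat_grng_mul cat_one_comp cat_one_l cat_one_r.

Section FunctorModule.
Variable F : cofunctor C.

Definition hact (Z : C) (g : C * C) (m : F Z) (a : rhom g) : dsum F :=
  if Z =P gran g is ReflectT e then
    dinj F (fmap F a (ecast Y (F Y) e m))
  else 0.

Lemma hactE X Y (m : F Y) (a : hom X Y) :
  @hact Y (Y, X) m a = dinj F (fmap F a m).
Proof. by rewrite /hact; case: eqP => //= e; rewrite eq_axiomK. Qed.

Lemma hact_neq Z g (m : F Z) (a : rhom g) : Z != gran g -> hact m a = 0.
Proof. by rewrite /hact; case: eqP. Qed.

Fact hactDl Z g (m m' : F Z) (a : rhom g) :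
  hact (m + m') a = hact m a + hact m' a.
Proof.
case: g a => Y X a; have [e|ne] := eqVneq Z Y.
  by subst Y; rewrite !hactE !raddfD.
by rewrite !hact_neq ?addr0.
Qed.

Fact hactDr Z g (m : F Z) (a a' : rhom g) :
  hact m (a + a') = hact m a + hact m a'.
Proof.
rewrite /hact; case: eqP => e; last by rewrite addr0.
by rewrite fmapD raddfD.
Qed.

Definition cact : dsum F -> cat_rng -> dsum F := dlift2 hact.

Fact cactDl m n a : cact (m + n) a = cact m a + cact n a.
Proof. by apply: dlift2Dl; [exact: hactDl|exact: hactDr]. Qed.

Fact cactDr m a b : cact m (a + b) = cact m a + cact m b.
Proof. by apply: dlift2Dr; [exact: hactDl|exact: hactDr]. Qed.

Lemma cact0l f : cact 0 f = 0.
Proof. by apply: (@addIr _ (cact 0 f)); rewrite -cactDl !add0r. Qed.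

Lemma cact0r f : cact f 0 = 0.
Proof. by apply: (@addIr _ (cact f 0)); rewrite -cactDr !add0r. Qed.

Lemma cact_dinj Z g (m : F Z) (a : rhom g) :
  cact (dinj F m) (dinj rhom a) = hact m a.
Proof. by apply: dlift2_dinj; [exact: hactDl|exact: hactDr]. Qed.

Fact cactA m a b : cact (cact m a) b = cact m (rmul a b).
Proof.
have -> : rmul a b = cmul a b by [].
elim/dsum_ind: m => [|f f' IH IH'|Z m]; first by rewrite !cact0l.
  by rewrite !cactDl IH IH'.
elim/dsum_ind: a => [|f f' IH IH'|g a].
- by rewrite cmul0l cact0r cact0l.
- by rewrite cmulDl !cactDr cactDl IH IH'.
elim/dsum_ind: b => [|f f' IH IH'|h b]; first by rewrite cmul0r !cact0r.
  by rewrite cmulDr !cactDr IH IH'.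
case: g h a b => [Z' Y] [Y' X] a b; rewrite cmul_dinj cact_dinj.
have [e|ne] := eqVneq Y Y'; last first.
  rewrite [hmul _ _]hmul_neq// cact0r.
  have [e|ne'] := eqVneq Z Z'; last by rewrite hact_neq// cact0l.
  by subst Z'; rewrite hactE cact_dinj hact_neq.
subst Y'; rewrite hmulE cact_dinj.
have [e|ne'] := eqVneq Z Z'; last by rewrite !hact_neq// cact0l.
by subst Z'; rewrite !hactE cact_dinj hactE fmap_comp.
Qed.

Definition functor_rmodule : rmodule cat_ring := RModule cactA cactDl cactDr.

Lemma ract_dinj Z g (m : F Z) (a : rhom g) :
  @ract cat_rng functor_rmodule (dinj F m) (dinj rhom a) = hact m a.
Proof. exact: cact_dinj. Qed.

Variable A : C.

Definition functor_comp (g : C * C) : set functor_rmodule :=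
  if gran g == A then range (@dinj _ F (gdom g)) else [set 0].

Fact functor_grading : is_grading functor_comp.
Proof.
apply: (@dsum_grading _ _ F (fun B => (A, B))).
- by move=> B; rewrite /functor_comp /gran eqxx.
- move=> [A' B]; rewrite /functor_comp /=; have [<-|_] := eqVneq; last by right.
  by left; exists B.
Qed.

Fact functor_act g h m (a : cat_ring) : functor_comp g m -> grng_comp h a ->
  comp_at functor_comp (gmul g h) (ract m a).
Proof.
case: g h => [A' Y] [Y' X]; rewrite /functor_comp /gmul /=.
case: eqVneq => [->|A'A]; last first.
  move=> -> _; case: ifP => _ /=; rewrite ?(negbTE A'A); exact: cact0l.
move=> [u _ <-] [f _ <-]; rewrite cact_dinj.
have [e|ne] := eqVneq Y Y'; last by rewrite hact_neq.
by subst Y'; rewrite hactE /= eqxx; exists (fmap F f u).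
Qed.

Fact functor_unital (m : functor_rmodule) :
  exists s : seq (functor_rmodule * cat_ring),
    m = \sum_(p <- s) ract p.1 p.2.
Proof.
exists [seq (dinj F (m X), cat_one X) | X <- supp m].
rewrite big_map [LHS](dsum_decomp (@notin_supp _ _ m)).
by apply: eq_bigr => X _; rewrite [RHS]cact_dinj hactE fmap1.
Qed.

(* M[F], its component of degree (A, B) being the summand F B. *)
Definition functor_module : graded_module cat_ring :=
  GradedModule functor_grading functor_act functor_unital.
End FunctorModule.
End CategoryRing.

(* Main.v *)
Require Import Defs.
From mathcomp Require Import all_boot.
From HB Require Import structures.
From mathcomp Require Import ssralg finmap.
From mathcomp Require Import boolp classical_sets cardinality fsbigop.

(** For each object [X] let [T X l = \sum_i F(l i)(x i)] be the component at
    [X] of the transformation determined by [I_(A i) |-> x i]. All three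
    conditions say that every [T X] is bijective.

    For a basis this is the definition, and a natural transformation is
    invertible as soon as its components are (the inverses are automatically
    natural: [nat_iso_bijective]).

    For a pseudo-basis, compare linear combinations in [M[F]] with the maps
    [T X]. Only the entry of degree [(A i, X)] of a coefficient [a i] moves
    [x i] into [F X], so the [X]-component of [\sum_i x i * a i] is [T X l],
    where [l i] is that entry ([sum_ract_component]). The elements of
    [1_(A i) R] are precisely those whose nonzero entries all have a degree
    [(A i, X)] ([cat_one_mul_row], [cat_one_mul_dinj]), so independence over
    such coefficients means that every [T X] is injective. Moreover, by
    naturality of [T], the elements of [M[F]] whose components all lie in the
    images of the maps [T X] form a submodule, so generation means that every
    [T X] is surjective. *)

Set Implicit Arguments.
Unset Strict Implicit.
Unset Printing Implicit Defensive.
Import GRing.Theory.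
Local Open Scope classical_set_scope.
Local Open Scope ring_scope.

(** * Subgroups and pointwise bijective transformations *)

Lemma subgroupD (M : zmodType) (N : set M) (m n : M) :
  subgroup N -> N m -> N n -> N (m + n).
Proof.
move=> [N0 NB] Nm Nn; rewrite -[n]opprK; apply: (NB) => //.
by rewrite -sub0r; apply: NB.
Qed.

(** Naturality and additivity of the inverses can be checked after applying the
    injective components of [t]. *)
Lemma nat_iso_bijective (C : preadditive) (F G : cofunctor C)
    (t : nat_trans F G) :
    (forall X u, t X u = 0 -> u = 0) -> (forall X v, exists u, v = t X u) ->
  nat_iso t.
Proof.
move=> t_inj t_surj.
have tI X : injective (t X).
  by move=> u v /eqP; rewrite -subr_eq0 -raddfB => /eqP/t_inj/eqP;
    rewrite subr_eq0 => /eqP.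
pose s X v := sval (cid (t_surj X v)).
have sK X : cancel (s X) (t X) by move=> v; rewrite /s; case: cid.
have tK X : cancel (t X) (s X) by move=> u; apply: tI; rewrite sK.
have s_additive X : zmod_morphism (s X).
  by move=> u v; apply: tI; rewrite raddfB !sK.
pose s' X : {additive G X -> F X} :=
  HB.pack (s X) (GRing.isZmodMorphism.Build _ _ (s X) (s_additive X)).
have s'_natural X Y (f : hom X Y) u : s' X (fmap G f u) = fmap F f (s' Y u).
  by apply: tI; rewrite nt_natural /= !sK.
by exists (NatTrans s'_natural); split=> X; [apply: tK|apply: sK].
Qed.

(** * Components of scalar multiples in the module of a functor *)

Section FunctorModuleComponents.
Variables (C : preadditive) (F : cofunctor C).

Lemma ract_homogeneous (m : functor_rmodule F) X Y (f : hom X Y) :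
  ract m (dinj (@rhom C) (i := (Y, X)) f : cat_rng C) =
  dinj F (fmap F f ((m : dsum F) Y)).
Proof.
rewrite -[LHS]/(cact m (dinj (@rhom C) (i := (Y, X)) f)).
elim/dsum_ind: m => [|m n IHm IHn|Z u].
- by rewrite cact0l !raddf0.
- by rewrite cactDl IHm IHn dsumDE !raddfD.
rewrite cact_dinj; have [e|ZY] := eqVneq Z Y.
  by subst Z; rewrite hactE dinjE.
by rewrite hact_neq// dinj_neq// !raddf0.
Qed.

Lemma ract_dinj_component Y (u : F Y) (r : cat_rng C) X :
  (ract (dinj F u : functor_rmodule F) r : dsum F) X =
  fmap F ((r : dsum (@rhom C)) (Y, X)) u.
Proof.
rewrite -[LHS]/(cact (dinj F u) r X).
elim/dsum_ind: r => [|r r' IHr IHr'|[Y' X'] f].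
- rewrite cact0r !dsum0E; exact: (esym (raddf0 (@feval C F X Y u))).
- by rewrite cactDr !dsumDE IHr IHr' fmapD.
rewrite [cact _ _]ract_homogeneous.
have [e|XX'] := eqVneq X' X; last first.
  rewrite !dinj_neq// ?[RHS](raddf0 (@feval C F X Y u))//.
  by apply: contraNneq XX' => -[_ ->].
subst X'; rewrite dinjE; have [e|YY'] := eqVneq Y' Y.
  by subst Y'; rewrite !dinjE.
rewrite !dinj_neq 1?eq_sym// ?raddf0; last first.
  by apply: contraNneq YY' => -[->].
exact: esym (raddf0 (@feval C F X Y u)).
Qed.

(** Left multiplication by the identity of [Y] is the projection of [R] onto
    the row of [Y]. *)
Lemma cat_one_mul_row (r : cat_rng C) Y g :
  gran g != Y -> (rmul (cat_one Y) r : dsum (@rhom C)) g = 0.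
Proof.
move=> gY; rewrite -[rmul _ _]/(cmul (cat_one Y) r).
elim/dsum_ind: r => [|r r' IHr IHr'|[Y' X'] f].
- by rewrite cmul0r.
- by rewrite cmulDr dsumDE IHr IHr' addr0.
rewrite cmul_dinj; have [e|YY'] := eqVneq Y Y'; last by rewrite hmul_neq.
subst Y'; rewrite hmulE dinj_neq//.
by apply: contraNneq gY => <-.
Qed.

Lemma cat_one_mul_dinj X Y (f : hom X Y) :
  rmul (cat_one Y : cat_rng C) (dinj (@rhom C) (i := (Y, X)) f) =
  dinj (@rhom C) (i := (Y, X)) f.
Proof. by rewrite [LHS]cmul_dinj hmulE comp1l. Qed.

End FunctorModuleComponents.

(** * Linear combinations of a family of elements *)

Section Combinations.
Variables (C : preadditive) (F : cofunctor C) (I : choiceType) (A_ : I -> C).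
Variable x : forall i, F (A_ i).

Let R := cat_rng C.
Let scal i (r : R) : functor_rmodule F :=
  ract (dinj F (x i) : functor_rmodule F) r.
HB.instance Definition _ i :=
  GRing.isZmodMorphism.Build R (functor_rmodule F) (@scal i)
    (add_zmod_morphism (@ractDr _ _ _)).

Fact entries_subproof (a : dsum (fun _ : I => R : zmodType)) X :
  finite_supp (fun i => (a i : dsum (@rhom C)) (A_ i, X) : hom X (A_ i)).
Proof.
apply/asboolP; apply: sub_finite_set (dsum_finite a) => i /=.
by apply: contra_neq => ->.
Qed.

Definition entries a X : dsum (fun i => hom X (A_ i)) :=
  DSum (entries_subproof a X).

Fact entries_inv_subproof X (l : dsum (fun i => hom X (A_ i))) :
  finite_supp
    (fun i => dinj (@rhom C) (i := (A_ i, X)) (l i) : (R : zmodType)).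
Proof.
apply/asboolP; apply: sub_finite_set (dsum_finite l) => i /=.
by apply: contra_neq => ->; rewrite raddf0.
Qed.

Definition homogeneous_coefs X l : dsum (fun _ : I => R : zmodType) :=
  DSum (@entries_inv_subproof X l).

Lemma entries_homogeneous_coefs X l : entries (homogeneous_coefs l) X = l.
Proof. by apply: dsumP => i; apply: (@dinjE _ (@rhom C) (A_ i, X)). Qed.

Lemma entries_homogeneous_coefs_neq X Y (l : dsum (fun i => hom X (A_ i))) :
  X != Y -> entries (homogeneous_coefs l) Y = 0.
Proof.
move=> XY; apply: dsumP => i.
apply: (@dinj_neq _ (@rhom C) (A_ i, X) (A_ i, Y)).
by apply: contraNneq XY => -[->].
Qed.

(** The coefficients [a i] range over the whole ring: an entry outside the row
    of [A_ i] annihilates [x i], and one of degree [(A_ i, Y)] moves it into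
    [F Y], so that [entries a X] is all that matters in [F X]. *)
Lemma sum_ract_component (a : dsum (fun _ : I => R : zmodType)) X :
  ((\sum_(i \in [set: I]) ract (dinj F (x i) : functor_rmodule F) (a i))
    : dsum F) X = rep_trans x X (entries a X).
Proof.
pose s := supp a.
have sa i : i \notin s -> a i = 0 by apply: notin_supp.
have se i : i \notin s -> entries a X i = 0.
  by move=> /sa; rewrite /entries /dsum_val /= => ->.
rewrite -[X in (X : dsum F) _]/(dlift (fun i => @scal i) a).
rewrite [RHS]/= (dlift_widen _ sa) (dlift_widen _ se).
rewrite -[LHS]/(dproj X _) raddf_sum; apply: eq_bigr => i _.
exact: ract_dinj_component.
Qed.

(** A relation [rep_trans x X l = 0] is tested by the coefficients concentrated
    in degrees [(A_ i, X)]: they lie in [1_(A_ i) R], and their combination has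
    no component outside [X]. *)
Lemma pseudo_basis_injective A :
  pseudo_basis (M := functor_module F A) (fun i => (A, A_ i))
    (fun i => dinj F (x i)) ->
  forall X l, rep_trans x X l = 0 -> l = 0.
Proof.
move=> [_ _ indep] X l Tl0.
rewrite -[l]entries_homogeneous_coefs.
have -> : homogeneous_coefs l = 0; last by apply: dsumP.
apply: indep => [i|].
  by exists (homogeneous_coefs l i); rewrite [RHS]cat_one_mul_dinj.
apply: dsumP => Y; rewrite [LHS]sum_ract_component.
have [e|XY] := eqVneq X Y.
  by subst Y; rewrite entries_homogeneous_coefs.
by rewrite entries_homogeneous_coefs_neq// raddf0.
Qed.

(** Naturality makes the images of the components of the transformation stable
    under the action of the homogeneous ring elements. *)
Lemma image_submodule :
  submodule (fun m : functor_rmodule F =>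
    forall X, exists l, (m : dsum F) X = rep_trans x X l).
Proof.
set N := fun m => _.
have NB : subgroup N.
  split=> [X|m n Nm Nn X]; first by exists 0; rewrite raddf0.
  have [[l ml] [k nk]] := (Nm X, Nn X).
  by exists (l - k); rewrite raddfB -ml -nk.
split=> // m a Nm; elim/dsum_ind: a => [|a b Na Nb|[Z Y] f].
- by rewrite [ract _ _]cact0r; case: NB.
- by rewrite ractDr; apply: (subgroupD NB Na Nb).
move=> X; rewrite ract_homogeneous.
have [e|YX] := eqVneq Y X; last by exists 0; rewrite dinj_neq// raddf0.
subst Y; have [l ml] := Nm Z.
by exists (fmap (rep_sum A_) f l); rewrite dinjE ml nt_natural.
Qed.

Lemma generates_surjective :
  generates (fun i => dinj F (x i) : functor_rmodule F) ->
  forall X v, exists l, v = rep_trans x X l.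
Proof.
move=> gen X v; have /gen NT := image_submodule.
have : [set: functor_rmodule F] (dinj F v) by [].
rewrite -NT => [/(_ X)|i Y]; first by rewrite dinjE.
have [e|AY] := eqVneq (A_ i) Y; last by exists 0; rewrite dinj_neq// raddf0.
subst Y; exists (dinj (fun j => rep (A_ j) (A_ i)) (idm (A_ i))).
by rewrite dinjE rep_trans_idm.
Qed.

(** An element [fmap F f (x i)] of the image, placed in the summand [F X], is
    the multiple of [x i] by the homogeneous ring element [f]. *)
Lemma surjective_generates :
  (forall X v, exists l, v = rep_trans x X l) ->
  generates (fun i => dinj F (x i) : functor_rmodule F).
Proof.
move=> surj N [NB NR] Nx; apply/seteqP; split=> // m _.
elim/dsum_ind: m => [|m n Nm Nn|X v]; first by case: NB.
  exact: (subgroupD NB Nm Nn).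
have [l ->] := surj X v.
elim/dsum_ind: l => [|l k Nl Nk|i f]; first by rewrite !raddf0; case: NB.
  by rewrite !raddfD; apply: (subgroupD NB Nl Nk).
rewrite /= dlift_dinj /= /feval -[x i]dinjE -ract_homogeneous.
exact: NR.
Qed.

Lemma injective_independent (a : dsum (fun _ : I => R : zmodType)) :
  (forall X l, rep_trans x X l = 0 -> l = 0) ->
  (forall i, exists r, a i = rmul (cat_one (A_ i)) r) ->
  \sum_(i \in [set: I]) ract (dinj F (x i) : functor_rmodule F) (a i) = 0 ->
  a = 0.
Proof.
move=> inj a1 sum0; apply: dsumP => i; apply: dsumP => -[Y X].
have [e|YA] := eqVneq Y (A_ i); last first.
  by have [r ->] := a1 i; rewrite cat_one_mul_row.
subst Y; have /inj e0 : rep_trans x X (entries a X) = 0.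
  by rewrite -sum_ract_component sum0.
by rewrite -[LHS]/(entries a X i) e0.
Qed.

End Combinations.

Theorem proposition8p9 (C : preadditive) (F : cofunctor C) (A : C)
    (I : choiceType) (A_ : I -> C) (x : forall i : I, F (A_ i)) :
  [<-> is_basis x;
       pseudo_basis (M := functor_module F A) (fun i : I => (A, A_ i))
         (fun i : I => dinj F (x i));
       nat_iso (rep_trans x)].
Proof.
tfae.
- move=> basis.
  have surj X v : exists l, v = rep_trans x X l.
    by have [l [vl _]] := basis X v; exists l.
  have inj X l : rep_trans x X l = 0 -> l = 0.
    have [k [_ k_unique]] := basis X 0; move=> Tl0.
    rewrite -(k_unique l); last exact: esym.
    by apply: k_unique; rewrite -[RHS]/(rep_trans x X 0) raddf0.
  split=> [i||a].
  + by rewrite /= /functor_comp eqxx; exists (x i).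
  + exact: surjective_generates.
  + exact: injective_independent.
- move=> pb; apply: nat_iso_bijective.
    exact: pseudo_basis_injective pb.
  by case: pb => _ gen _; apply: generates_surjective.
- move=> [t [tK sK]] B y; exists (t B y); split; first exact: esym (sK B y).
  by move=> l ->; apply: tK.
Qed.
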